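(* Let $\mu$ be a symmetric probability measure on $\mathbb{R}$ with $\int x^2\,d\mu(x)<\infty$. Then $$\Gamma(\mu|\mathrm{b})\le W_2(\mu,\mathrm{b})\,\sqrt{\Psi^*(\mu|\mathrm{b})}-\frac12\,W_2(\mu,\mathrm{b})^2.$$
   Context: $\mathrm{b}=\frac12\delta_{-1}+\frac12\delta_{1}$ is the Rademacher distribution. $W_2(\mu,\nu)=\inf_\pi\left(\iint|x-y|^2\,d\pi(x,y)\right)^{1/2}$, the infimum being over all couplings of $(\mu,\nu)$. For a symmetric probability measure $\mu$ on $\mathbb{R}$, $$\Gamma(\mu|\mathrm{b})=\frac12\int x^2\,d\mu(x)-\int\log|x|\,d\mu(x)-\frac12\in[0,+\infty],$$ $$\Psi^*(\mu|\mathrm{b})=\int\frac1{x^2}\,d\mu(x)+\int x^2\,d\mu(x)-2\in[0,+\infty],$$ with $1/0=+\infty$. *)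

(* Defs.v *)
From HB Require Import structures.
From mathcomp Require Import all_boot all_order all_algebra.
From mathcomp Require Import all_classical all_reals all_analysis.

Set Implicit Arguments.
Unset Strict Implicit.
Unset Printing Implicit Defensive.
Import Order.TTheory GRing.Theory Num.Theory.
Import numFieldNormedType.Exports.

Local Open Scope classical_set_scope.
Local Open Scope ring_scope.
Local Open Scope ereal_scope.

Section rademacher.
Variable R : realType.

Definition rademacher : set (measurableTypeR R) -> \bar R :=
  measure_add (mscale ((2^-1)%:nng)%R (dirac (-1 : measurableTypeR R)%R))
              (mscale ((2^-1)%:nng)%R (dirac (1 : measurableTypeR R)%R)).

HB.instance Definition _ := Measure.on rademacher.

Let rademacher_setT : rademacher setT = 1.
Proof.
rewrite /rademacher measure_addE/= /mscale/= !diracT !mule1 -EFinD.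
by congr EFin; rewrite /= [RHS]splitr div1r.
Qed.

HB.instance Definition _ :=
  Measure_isProbability.Build _ _ R rademacher rademacher_setT.

End rademacher.
Arguments rademacher R : clear implicits.

Section definitions.
Variable R : realType.
Local Notation RB := (measurableTypeR R).
Implicit Types mu nu : probability RB R.

Definition symmetric_measure mu : Prop :=
  forall A : set RB, measurable A ->
    pushforward mu (fun x : RB => (- x)%R : RB) A = mu A.

Definition coupling mu nu (pi : probability (RB * RB)%type R) : Prop :=
  (forall A : set RB, measurable A -> pushforward pi fst A = mu A) /\
  (forall B : set RB, measurable B -> pushforward pi snd B = nu B).

Definition W2 mu nu : \bar R :=
  ereal_inf [set sqrte (\int[pi]_z ((`|z.1 - z.2| ^+ 2)%R)%:E)
            | pi in [set pi | coupling mu nu pi]].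

(* [lne] is the extended logarithm, so log|x| is -oo at x = 0. When the second
   moment is finite, the integral of log|x| is in [-oo, +oo[, so the
   difference below is never of the form +oo - +oo. *)
Definition Gamma_rademacher mu : \bar R :=
  (2^-1)%:E * (\int[mu]_x (x ^+ 2)%:E) - \int[mu]_x lne (`|x|%R)%:E
  - (2^-1)%:E.

(* The inverse is taken in [\bar R], where the inverse of 0 is +oo; the
   real inverse of 0 would be 0. *)
Definition Psistar_rademacher mu : \bar R :=
  \int[mu]_x ((x ^+ 2)%:E)^-1 + \int[mu]_x (x ^+ 2)%:E - 2%:E.

End definitions.

(* Main.v *)
(**
  For symmetric [mu] the optimal coupling with the Rademacher law sends [x] to its
  sign, so [W2^2 = int (|x| - 1)^2].  Write [r = |x|].  The integrand of [Psi*] is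
  [(r - 1/r)^2], hence Cauchy-Schwarz bounds [K = int (r - 1) (r - 1/r)] by
  [W2 sqrt Psi*].  Since [(r - 1) (r - 1/r) - (r - 1)^2 / 2 = r^2/2 + 1/r - 3/2],
  the inequality [- ln r <= 1/r - 1] gives [Gamma <= K - W2^2 / 2].
  If [Psi* = +oo], then [0 < W2 < +oo] and the right-hand side is [+oo].
*)
Require Import Defs.
From HB Require Import structures.
From mathcomp Require Import all_boot all_order all_algebra.
From mathcomp Require Import all_classical all_reals all_analysis.
From mathcomp Require Import measurable_realfun.
From mathcomp Require Import ring lra.

Set Implicit Arguments.
Unset Strict Implicit.
Unset Printing Implicit Defensive.
Import Order.TTheory GRing.Theory Num.Theory.
Import numFieldNormedType.Exports.

Local Open Scope classical_set_scope.
Local Open Scope ring_scope.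
Local Open Scope ereal_scope.

(** The discriminant criterion [b^2 <= a c], which turns nonnegativity of a quadratic of moments
    into Cauchy-Schwarz. *)
Lemma quadratic_ge0_le_sqrt (R : rcfType) (a b c : R) : (0 <= a)%R -> (0 <= c)%R ->
  (forall t : R, 0 <= t ^+ 2 * a - 2 * t * b + c)%R ->
  (b <= Num.sqrt a * Num.sqrt c)%R.
Proof.
move=> a0 c0 abc; rewrite -sqrtrM//.
have [b0|b0] := leP b 0%R; first exact: le_trans (sqrtr_ge0 _).
rewrite -[leLHS]gtr0_norm// -sqrtr_sqr ler_sqrt ?mulr_ge0//.
have [a_eq0|a_neq0] := eqVneq a 0%R.
  (* With [a = 0] the quadratic is affine; at this [t] it equals [-1], a contradiction. *)
  have := abc ((c + 1) / (2 * b))%R.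
  rewrite a_eq0 mulr0 add0r -mulrA (mulrC 2%R) -!mulrA.
  have -> : ((2 * b)^-1 * (b * 2) = 1)%R by field; rewrite gt_eqF.
  lra.
have a_gt0 : (0 < a)%R by rewrite lt_neqAle eq_sym a_neq0.
(* The minimiser of the quadratic. *)
have := abc (b / a)%R.
have -> : ((b / a) ^+ 2 * a - 2 * (b / a) * b + c = (a * c - b ^+ 2) / a)%R.
  by field; rewrite gt_eqF.
by rewrite pmulr_lge0 ?invr_gt0// subr_ge0.
Qed.

Lemma measurable_invr (R : realType) (D : set R) : measurable_fun D (@GRing.inv R).
Proof.
apply: (@measurable_funS _ _ _ _ setT) => //.
(* [0 `^ (-1) = 0 = 0^-1], so [powR] also covers [x = 0]. *)
rewrite (_ : GRing.inv = fun x : R => (if x < 0 then - ((- x) `^ (-1)) else x `^ (-1))%R).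
  apply: measurable_fun_ifT => //.
  - exact: measurable_fun_ltr.
  - apply: measurableT_comp => //.
    exact: (measurableT_comp (@measurable_powR R (-1))).
apply/funext => x; case: ltP => x0.
  by rewrite powR_inv1 ?oppr_ge0 1?ltW// invrN opprK.
by rewrite powR_inv1.
Qed.

(** * The inequality for a positive random variable with finite moments of order 2 and -2 *)

Section positive_random_variable.
Context disp (T : measurableType disp) (R : realType) (P : probability T R).
Variable r : T -> R.
Hypotheses (mr : measurable_fun setT r) (r_gt0 : forall x, (0 < r x)%R).
Hypothesis r2_lty : \int[P]_x (r x ^+ 2)%:E < +oo.
Hypothesis rV2_lty : \int[P]_x ((r x)^-1 ^+ 2)%:E < +oo.

Let mrV : measurable_fun setT (fun x => (r x)^-1)%R.
Proof. by apply: measurableT_comp => //; exact: measurable_invr. Qed.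

Let integrable_sqr (f : T -> R) : measurable_fun setT f ->
  \int[P]_x (f x ^+ 2)%:E < +oo -> P.-integrable setT (fun x => (f x ^+ 2)%:E).
Proof.
move=> mf f2; apply/integrableP; split.
  by apply/measurable_EFinP; exact: measurable_funX.
by under eq_integral do rewrite gee0_abs ?lee_fin ?sqr_ge0//.
Qed.

(** Domination by [1 + f^2], integrable because [P] is finite; the bound comes from
    [(|f| - 1)^2 >= 0]. *)
Let integrable_of_sqr (f : T -> R) : measurable_fun setT f ->
  P.-integrable setT (fun x => (f x ^+ 2)%:E) -> P.-integrable setT (EFin \o f).
Proof.
move=> mf f2.
apply: (@le_integrable _ _ _ _ _ measurableT _
  (EFin \o cst 1%R \+ fun x => (f x ^+ 2)%:E)).
- exact/measurable_EFinP.
- move=> x _ /=; rewrite lee_fin [leRHS]ger0_norm ?addr_ge0 ?sqr_ge0//.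
  rewrite -real_normK ?num_real//; have := sqr_ge0 (`|f x| - 1)%R.
  by have := normr_ge0 (f x); nra.
- by apply: integrableD => //; exact: finite_measure_integrable_cst.
Qed.

Let int_r2 := integrable_sqr mr r2_lty.
Let int_rV2 := integrable_sqr mrV rV2_lty.
Let int_r := integrable_of_sqr mr int_r2.
Let int_rV := integrable_of_sqr mrV int_rV2.

(** Apart from [ln r], the integrands below are Laurent polynomials in [r] of degrees -2 to 2; this
    common form lets integrability and linearity be proved once. *)
Let laurent (a b c d e : R) x : R :=
  (a * r x ^+ 2 + b * r x + c + d * (r x)^-1 + e * (r x)^-1 ^+ 2)%R.

Let I k : R := Rintegral P setT (fun x => r x ^+ k)%R.
Let J k : R := Rintegral P setT (fun x => (r x)^-1 ^+ k)%R.

Let int_Zl (k : R) (f : T -> R) : P.-integrable setT (EFin \o f) ->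
  P.-integrable setT (EFin \o (fun x => k * f x)%R).
Proof. exact: (integrableZl measurableT). Qed.

Let int_D (f g : T -> R) : P.-integrable setT (EFin \o f) ->
  P.-integrable setT (EFin \o g) ->
  P.-integrable setT (EFin \o (fun x => f x + g x)%R).
Proof. exact: (integrableD measurableT). Qed.

Let int_cst (k : R) : P.-integrable setT (EFin \o fun=> k).
Proof. exact: finite_measure_integrable_cst. Qed.

Let int_laurent a b c d e : P.-integrable setT (EFin \o laurent a b c d e).
Proof. by do ?[apply: int_D|apply: int_Zl|apply: int_cst]. Qed.

Let Rintegral_laurent a b c d e :
  Rintegral P setT (laurent a b c d e) =
  (a * I 2 + b * I 1 + c + d * J 1 + e * J 2)%R.
Proof.
rewrite /laurent /I /J !RintegralD//; do ?[apply: int_D|apply: int_Zl|apply: int_cst] => //.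
rewrite !RintegralZl// Rintegral_cst// (_ : fine _ = 1%R) ?mulr1//.
exact: (congr1 fine (probability_setT P)).
Qed.

(** [ln y < y] at [r] and at [1/r] gives the integrable bound [|ln r| <= r + 1/r]. *)
Let int_ln : P.-integrable setT (EFin \o (fun x => ln (r x))).
Proof.
apply: (le_integrable measurableT _ _ (int_laurent 0 1 0 1 0)).
  by apply/measurable_EFinP/measurableT_comp => //; exact: measurable_ln.
move=> x _; rewrite lee_fin /laurent.
have rV_gt0 : (0 < (r x)^-1)%R by rewrite invr_gt0.
have := ln_sublinear (r_gt0 x); have := ln_sublinear rV_gt0.
rewrite lnV ?posrE// => h1 h2.
rewrite [leRHS]ger0_norm; last by have := r_gt0 x; lra.
by rewrite ler_norml; have := r_gt0 x; lra.
Qed.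

Let ln_ge : (1 - J 1 <= Rintegral P setT (fun x => ln (r x)))%R.
Proof.
rewrite [leLHS](_ : _ = Rintegral P setT (laurent 0 0 1 (-1) 0)); last first.
  by rewrite Rintegral_laurent; ring.
apply: le_Rintegral => //; first exact: int_laurent.
move=> x _; rewrite /laurent.
have rV_gt0 : (0 < (r x)^-1)%R by rewrite invr_gt0.
have := @le_ln1Dx _ ((r x)^-1 - 1)%R.
by rewrite addrCA subrr addr0 lnV ?posrE//; lra.
Qed.

Let EFin_Rintegral f : P.-integrable setT (EFin \o f) ->
  \int[P]_x (f x)%:E = (Rintegral P setT f)%:E.
Proof. by move=> fi; rewrite fineK//; exact: integrable_fin_num. Qed.

(** Cauchy-Schwarz for [r - 1] and [r - 1/r], with the product and both squares expanded into
    moments. *)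
Let moment_cauchy_schwarz :
  (I 2 - 1 - I 1 + J 1 <=
   Num.sqrt (I 2 - 2 * I 1 + 1) * Num.sqrt (J 2 + I 2 - 2))%R.
Proof.
have sq_ge0 s t : (0 <= Rintegral P setT
    (fun x => (s * (r x - 1) - t * (r x - (r x)^-1)) ^+ 2)%R)%R.
  by apply: Rintegral_ge0 => x _; exact: sqr_ge0.
have sqE s t : Rintegral P setT
    (fun x => (s * (r x - 1) - t * (r x - (r x)^-1)) ^+ 2)%R =
    (s ^+ 2 * (I 2 - 2 * I 1 + 1) - 2 * s * t * (I 2 - 1 - I 1 + J 1)
     + t ^+ 2 * (J 2 + I 2 - 2))%R.
  rewrite (_ : (fun x => _) = laurent (s ^+ 2 - 2 * s * t + t ^+ 2)
    (2 * s * t - 2 * s ^+ 2) (s ^+ 2 + 2 * s * t - 2 * t ^+ 2)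
    (- 2 * s * t) (t ^+ 2)); last first.
    by apply/funext => x; rewrite /laurent; field; rewrite gt_eqF.
  by rewrite Rintegral_laurent; ring.
(* The pairs [(1, 0)] and [(0, 1)] give the signs of the outer coefficients; [(t, 1)] gives the
   quadratic in [t]. *)
apply: quadratic_ge0_le_sqrt => [||t].
- by have := sq_ge0 1%R 0%R; rewrite sqE; lra.
- by have := sq_ge0 0%R 1%R; rewrite sqE; lra.
- by have := sq_ge0 t 1%R; rewrite sqE; lra.
Qed.

Lemma HWI_positive :
  (2^-1)%:E * (\int[P]_x (r x ^+ 2)%:E) - \int[P]_x (ln (r x))%:E - (2^-1)%:E <=
  sqrte (\int[P]_x ((r x - 1) ^+ 2)%:E) *
    sqrte (\int[P]_x ((r x)^-1 ^+ 2)%:E + \int[P]_x (r x ^+ 2)%:E - 2%:E)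
  - (2^-1)%:E * \int[P]_x ((r x - 1) ^+ 2)%:E.
Proof.
have D2E : \int[P]_x ((r x - 1) ^+ 2)%:E = (I 2 - 2 * I 1 + 1)%:E.
  rewrite (_ : (fun x => _) = EFin \o laurent 1 (-2) 1 0 0); last first.
    by apply/funext => x; rewrite /laurent /=; congr EFin; ring.
  by rewrite EFin_Rintegral// Rintegral_laurent; congr EFin; ring.
rewrite D2E !EFin_Rintegral// -/(I 2) -/(J 2).
rewrite -!(EFinM, EFinB, EFinD) lee_fin.
(* [ln_ge] bounds the left side by [I 2 / 2 + J 1 - 3/2]. This equals the left side of
   [moment_cauchy_schwarz] minus half of [I 2 - 2 * I 1 + 1], as the [I 1] terms cancel. *)
by have := moment_cauchy_schwarz; have := ln_ge; lra.
Qed.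

End positive_random_variable.

(** * Equal-weight mixtures of two probability laws *)

Section half_mixture.
Context d (T : measurableType d) (R : realType) (P Q : probability T R).

Definition half_mixture : set T -> \bar R :=
  measure_add (mscale ((2^-1)%:nng)%R P) (mscale ((2^-1)%:nng)%R Q).

HB.instance Definition _ := Measure.on half_mixture.

Lemma half_mixtureE A : half_mixture A = (2^-1)%:E * (P A + Q A).
Proof.
by rewrite /half_mixture measure_addE/= /mscale/= ge0_muleDr.
Qed.

Let half_mixture_setT : half_mixture setT = 1.
Proof.
rewrite half_mixtureE !probability_setT -EFinD -EFinM; congr EFin.
by rewrite -mulr2n mulVf.
Qed.

HB.instance Definition _ :=
  Measure_isProbability.Build _ _ R half_mixture half_mixture_setT.

Lemma ge0_integral_half_mixture (f : T -> \bar R) : measurable_fun setT f ->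
  (forall x, 0 <= f x) ->
  \int[half_mixture]_x f x = (2^-1)%:E * (\int[P]_x f x + \int[Q]_x f x).
Proof.
move=> mf f0; rewrite ge0_integral_measure_add// !ge0_integral_mscale//=.
by rewrite -ge0_muleDr//; exact: integral_ge0.
Qed.

End half_mixture.

(** * The optimal coupling with the Rademacher law and the value of [W2] *)

Section signed_abs.
Variable R : realType.
Local Notation RB := (measurableTypeR R).

Definition signed_abs (s : RB) (x : RB) : (RB * RB)%type := (s * `|x|, s)%R.

Let measurable_smul (s : RB) : measurable_fun setT (fun x : RB => s * `|x|)%R.
Proof. by apply: measurable_funM => //; exact: normr_measurable. Qed.

Let measurable_signed_abs s : measurable_fun setT (signed_abs s).
Proof.
by apply: measurable_fun_pair => //; exact: measurable_smul.
Qed.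

HB.instance Definition _ (s : RB) :=
  isMeasurableFun.Build _ _ _ _ (signed_abs s) (measurable_signed_abs s).

(** The law of [(s |x|, s)] with [s] an independent uniform sign. Unlike the sign of [x], this
    splits a possible atom at 0 evenly between [1] and [-1]. *)
Definition sign_coupling (mu : probability RB R) : probability (RB * RB)%type R :=
  half_mixture (distribution mu (signed_abs 1%R)) (distribution mu (signed_abs (-1)%R)).

Lemma sign_couplingE mu A : sign_coupling mu A = (2^-1)%:E *
  (mu (signed_abs 1%R @^-1` A) + mu (signed_abs (-1)%R @^-1` A)).
Proof. exact: half_mixtureE. Qed.

Lemma rademacherE A : rademacher R A = (2^-1)%:E * (dirac (-1 : RB)%R A + dirac (1 : RB)%R A).
Proof. by rewrite /rademacher measure_addE/= /mscale/= ge0_muleDr. Qed.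

(* With [A'] the reflection of [A], the preimages of [A] under [|x|] and [-|x|]
   together have the same measure as [A'] and [A]: swap the parts in [x < 0]. *)
Lemma sign_couplingP (mu : probability RB R) : symmetric_measure mu ->
  coupling mu (rademacher R) (sign_coupling mu).
Proof.
move=> mu_sym; split => A mA; rewrite /pushforward sign_couplingE.
- pose H : set RB := [set x | 0 <= x]%R.
  pose A' : set RB := [set x | A (- x)%R].
  have mH : measurable H by rewrite /H -set_itvcy; exact: measurable_itv.
  have mA' : measurable A'.
    by rewrite -[A']setTI; exact: measurable_funN.
  have AA' : mu A' = mu A := mu_sym _ mA.
  pose Ap : set RB := [set x | A (1 * `|x|)%R].
  pose An : set RB := [set x | A (-1 * `|x|)%R].
  have mAp : measurable Ap.
    by rewrite -[Ap]setTI; exact: (measurable_smul 1%R).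
  have mAn : measurable An.
    by rewrite -[An]setTI; exact: (measurable_smul (-1)%R).
  have mu_split B : measurable B -> mu B = mu (B `\` H) + mu (B `&` H).
    by move=> mB; exact: measureDI.
  have H_lt0 x : ~ H x -> (x < 0)%R by rewrite ltNge => /negP.
  have ApH : Ap `&` H = A `&` H.
    by apply/seteqP; split => x [] + x0;
      rewrite /Ap /= mul1r ger0_norm//; split.
  have ApD : Ap `\` H = A' `\` H.
    by apply/seteqP; split => x [] + xH; have x0 := H_lt0 _ xH;
      rewrite /Ap /A' /= mul1r ltr0_norm//; split.
  have AnH : An `&` H = A' `&` H.
    by apply/seteqP; split => x [] + x0;
      rewrite /An /A' /= mulN1r ger0_norm//; split.
  have AnD : An `\` H = A `\` H.
    by apply/seteqP; split => x [] + xH; have x0 := H_lt0 _ xH;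
      rewrite /An /= mulN1r ltr0_norm// opprK; split.
  have -> : mu Ap + mu An = mu A' + mu A.
    rewrite (mu_split _ mAp) (mu_split _ mAn) ApH ApD AnH AnD.
    rewrite (mu_split _ mA') (mu_split _ mA) addeACA [RHS]addeACA.
    by congr (_ + _); rewrite addeC.
  rewrite AA' -[in RHS](fineK (fin_num_measure mu A mA)).
  rewrite -[in LHS](fineK (fin_num_measure mu A mA)) -EFinD -EFinM.
  by congr EFin; lra.
- apply: (eq_trans _ (esym (rademacherE A))); congr (_ * _).
  (* The second coordinate of [signed_abs s] is the constant [s], so its law is the Dirac mass at
     [s]. *)
  suff cst_preimage (s : RB) : mu (signed_abs s @^-1` (snd @^-1` A)) = \d_s A.
    by rewrite !cst_preimage addeC.
  rewrite diracE; have [As|nAs] := boolP (s \in A).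
    rewrite (_ : _ @^-1` _ = setT); first exact: probability_setT.
    by apply/seteqP; split => // x _ /=; exact/set_mem.
  rewrite (_ : _ @^-1` _ = set0); first exact: measure0.
  by apply/seteqP; split => // x /= As; move: nAs; rewrite notin_setE.
Qed.

Let measurable_cost :
  measurable_fun setT (fun z : RB * RB => ((`|z.1 - z.2| ^+ 2)%R)%:E).
Proof.
apply/measurable_EFinP/measurable_funX/measurableT_comp => //.
exact: measurable_funB.
Qed.

Let measurable_abs_cost :
  measurable_fun setT (fun x : RB => (((`|x| - 1) ^+ 2)%R)%:E).
Proof. exact/measurable_EFinP/measurable_funX/measurable_funB. Qed.

(** Both signs contribute the same cost, since [(s |x| - s)^2 = s^2 (|x| - 1)^2] and [s^2 = 1]. *)
Lemma integral_sign_coupling (mu : probability RB R) :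
  \int[sign_coupling mu]_z ((`|z.1 - z.2| ^+ 2)%R)%:E =
  \int[mu]_x ((`|x| - 1) ^+ 2)%:E.
Proof.
rewrite [LHS]ge0_integral_half_mixture//.
have int_signed (s : RB) : (s ^+ 2 = 1)%R ->
    \int[distribution mu (signed_abs s)]_z ((`|z.1 - z.2| ^+ 2)%R)%:E =
    \int[mu]_x ((`|x| - 1) ^+ 2)%:E.
  move=> s2_eq1; rewrite ge0_integral_pushforward//.
  apply: eq_integral => x _ /=; congr EFin.
  by rewrite real_normK ?num_real// -[X in (_ - X)%R]mulr1 -mulrBr exprMn s2_eq1 mul1r.
rewrite !int_signed ?sqrrN ?expr1n//.
have : 0 <= \int[mu]_x ((`|x| - 1) ^+ 2)%:E.
  by apply: integral_ge0 => x _; rewrite lee_fin sqr_ge0.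
move: (\int[mu]_x _) => v v_ge0.
rewrite ge0_muleDr// -ge0_muleDl// -EFinD [X in X%:E](_ : _ = 1%R) ?mul1e//.
by lra.
Qed.

(** Optimality of [sign_coupling]: under [pi] almost surely [|z.2| = 1], and the reverse triangle
    inequality gives [| |z.1| - 1 | <= |z.1 - z.2|]. *)
Lemma coupling_rademacher_ge (mu : probability RB R)
    (pi : probability (RB * RB)%type R) : coupling mu (rademacher R) pi ->
  \int[mu]_x ((`|x| - 1) ^+ 2)%:E <= \int[pi]_z ((`|z.1 - z.2| ^+ 2)%R)%:E.
Proof.
move=> [pi_fst pi_snd].
have fst_meas : measurable_fun setT (fst : RB * RB -> RB) by [].
rewrite -(@eq_measure_integral _ _ _ _ mu (pushforward pi fst)); last first.
  by move=> A mA _; exact: pi_fst.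
have sq_ge0 (x : R) : 0 <= (x ^+ 2)%:E by rewrite lee_fin sqr_ge0.
rewrite ge0_integral_pushforward//= preimage_setT.
apply: ae_ge0_le_integral => //.
  exact: (measurableT_comp measurable_abs_cost fst_meas).
have mN : measurable [set y : RB | `|y| <> 1]%R.
  rewrite (_ : mkset _ = ~` ((fun y : RB => `|y|%R) @^-1` [set 1%R]))//.
  apply: measurableC; rewrite -[X in measurable X]setTI.
  exact: (@normr_measurable R setT).
(* The exceptional set is null because its mass is read off the second marginal, which is carried by
   [1] and [-1]. *)
exists (snd @^-1` [set y : RB | `|y| <> 1]%R); split.
- by rewrite -[X in measurable X]setTI; exact: measurable_snd.
- apply: (eq_trans (pi_snd _ mN)); apply: (eq_trans (rademacherE _)).
  rewrite !diracE !memNset ?adde0 ?mule0//=;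
    by rewrite ?normrN normr1; apply.
- move=> z; apply: contra_not => /= z2 _; rewrite lee_fin.
  rewrite -z2 -[leLHS]real_normK ?num_real// lerXn2r ?nnegrE//.
  exact: ler_dist_dist.
Qed.

Lemma W2_rademacher (mu : probability RB R) : symmetric_measure mu ->
  W2 mu (rademacher R) = sqrte (\int[mu]_x ((`|x| - 1) ^+ 2)%:E).
Proof.
move=> mu_sym; apply/eqP; rewrite eq_le; apply/andP; split.
  apply: ereal_inf_lbound; exists (sign_coupling mu); first exact: sign_couplingP.
  by rewrite integral_sign_coupling.
apply/ereal_infP => _ [pi pi_coupling <-].
rewrite lee_sqrt; last by apply: integral_ge0 => z _; rewrite lee_fin sqr_ge0.
exact: coupling_rademacher_ge.
Qed.

End signed_abs.

(** * Passage from extended-real integrands in [|x|] to a positive real variable *)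

Section rademacher_HWI.
Variable R : realType.
Local Notation RB := (measurableTypeR R).
Variable mu : probability RB R.

Let measurable_eq0 : measurable_fun setT (fun x : RB => x == 0%R).
Proof. exact: measurable_fun_eqr. Qed.

Let inve_sqr (x : R) :
  ((x ^+ 2)%:E)^-1 = if (x == 0)%R then +oo else ((`|x|^-1 ^+ 2)%R)%:E.
Proof.
by rewrite inver sqrf_eq0; case: ifP => // _; rewrite exprVn real_normK ?num_real.
Qed.

Let measurable_inve_sqr : measurable_fun setT (fun x : RB => ((x ^+ 2)%:E)^-1).
Proof.
under eq_fun do rewrite inve_sqr.
apply: measurable_fun_ifT => //.
apply/measurable_EFinP/measurable_funX; apply: measurableT_comp => //.
exact: measurable_invr.
Qed.

Let lne_norm (x : R) : lne (`|x|%R)%:E = if (x == 0)%R then -oo else (ln `|x|%R)%:E.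
Proof.
have [->|x0] := eqVneq x 0%R; first by rewrite normr0 le0_lneNy.
by rewrite lne_EFin ?normr_gt0.
Qed.

Let measurable_lne_norm : measurable_fun setT (fun x : RB => lne (`|x|%R)%:E).
Proof.
under eq_fun do rewrite lne_norm.
apply: measurable_fun_ifT => //.
exact/measurable_EFinP/measurableT_comp.
Qed.

Let sq_ge0 (x : R) : 0 <= (x ^+ 2)%:E.
Proof. by rewrite lee_fin sqr_ge0. Qed.

Let inve_sq_ge0 (x : R) : 0 <= ((x ^+ 2)%:E)^-1.
Proof. by rewrite inve_ge0. Qed.

Lemma integral_eq_off0 (f g : RB -> \bar R) : mu [set 0%R] = 0 ->
  measurable_fun setT f -> measurable_fun setT g ->
  (forall x, x != 0%R -> f x = g x) -> \int[mu]_x f x = \int[mu]_x g x.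
Proof.
move=> mu0 mf mg fg; apply: ae_eq_integral => //.
exists [set 0%R]; split => //.
by move=> x /= /not_implyP[_ fgx]; apply: contrapT => /eqP /fg.
Qed.

(** An integrable function is finite almost everywhere, whereas [1/x^2] is [+oo] at 0. *)
Lemma set0_null_of_inve_sqr_lty :
  \int[mu]_x ((x ^+ 2)%:E)^-1 < +oo -> mu [set 0%R] = 0.
Proof.
move=> J_lty; apply: measure_negligible => //.
have int_J : mu.-integrable setT (fun x : RB => ((x ^+ 2)%:E)^-1).
  apply/integrableP; split => //.
  by under eq_integral do rewrite gee0_abs//.
apply: negligibleS (integrable_ae measurableT int_J) => x /= ->.
by move=> /(_ I); rewrite inve_sqr eqxx.
Qed.

(** If the integral vanished, then [|x| = 1] almost surely and [1/x^2] would integrate to 1.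
    Positivity matters because [0 * +oo] is 0 in the extended reals. *)
Lemma abs_sub1_integral_gt0 : \int[mu]_x ((x ^+ 2)%:E)^-1 = +oo ->
  0 < \int[mu]_x ((`|x| - 1) ^+ 2)%:E.
Proof.
move=> J_y; rewrite lt_neqAle integral_ge0// andbT; apply/eqP => D0.
suff : \int[mu]_x ((x ^+ 2)%:E)^-1 = 1 by rewrite J_y.
have mD : measurable_fun setT (fun x : RB => ((`|x| - 1) ^+ 2)%:E).
  exact/measurable_EFinP/measurable_funX/measurable_funB.
have := ae_eq_integral_abs mu measurableT mD.
under eq_integral do rewrite gee0_abs//.
move=> [/(_ (esym D0)) D_ae0 _].
rewrite (ae_eq_integral (cst 1))//.
  by rewrite integral_cst// mul1e; exact: probability_setT.
apply: filterS D_ae0 => x /(_ I) /= [] /eqP.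
rewrite inve_sqr sqrf_eq0 subr_eq0 => /eqP x1 _.
by rewrite -normr_eq0 x1 oner_eq0 invr1 expr1n.
Qed.

(** From [(|x| - 1)^2 <= x^2 + 1]. It keeps the term subtracted on the right-hand side finite. *)
Lemma abs_sub1_integral_lty : \int[mu]_x (x ^+ 2)%:E < +oo ->
  \int[mu]_x ((`|x| - 1) ^+ 2)%:E < +oo.
Proof.
move=> I_lty.
have mI : measurable_fun setT (fun x : RB => (x ^+ 2)%:E).
  exact/measurable_EFinP/measurable_funX.
apply: (@le_lt_trans _ _ (\int[mu]_x ((x ^+ 2)%:E + cst 1 x))).
  apply: ge0_le_integral => //.
  - exact/measurable_EFinP/measurable_funX/measurable_funB.
  - exact: emeasurable_funD.
  - move=> x _; rewrite -EFinD lee_fin sqrrB1 real_normK ?num_real//.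
    by have := normr_ge0 x; lra.
rewrite ge0_integralD// integral_cst// mul1e lte_add_pinfty//.
by apply: le_lt_trans (ltry 1%R); exact: probability_le1.
Qed.

Lemma abs_HWI : \int[mu]_x (x ^+ 2)%:E < +oo -> \int[mu]_x ((x ^+ 2)%:E)^-1 < +oo ->
  (2^-1)%:E * (\int[mu]_x (x ^+ 2)%:E) - \int[mu]_x lne (`|x|%R)%:E - (2^-1)%:E <=
  sqrte (\int[mu]_x ((`|x| - 1) ^+ 2)%:E) *
    sqrte (\int[mu]_x ((x ^+ 2)%:E)^-1 + \int[mu]_x (x ^+ 2)%:E - 2%:E)
  - (2^-1)%:E * \int[mu]_x ((`|x| - 1) ^+ 2)%:E.
Proof.
move=> I_lty J_lty.
have mu0 := set0_null_of_inve_sqr_lty J_lty.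
(* [mu] has no atom at 0, so [r] is a positive version of [|x|]. *)
pose r (x : RB) : R := if (x == 0)%R then 1%R else `|x|%R.
have mr : measurable_fun setT r by exact: measurable_fun_ifT.
have r_gt0 x : (0 < r x)%R.
  by rewrite /r; have [//|x0] := eqVneq x 0%R; rewrite normr_gt0.
have rE x : x != 0%R -> r x = `|x|%R by rewrite /r => /negbTE ->.
have mrX (f : R -> R) : measurable_fun setT f ->
    measurable_fun setT (fun x => (f (r x))%:E).
  by move=> mf; exact/measurable_EFinP/measurableT_comp.
have mX : measurable_fun setT (fun x : R => x ^+ 2)%R by exact: measurable_funX.
have IE : \int[mu]_x (x ^+ 2)%:E = \int[mu]_x (r x ^+ 2)%:E.
  apply: integral_eq_off0 => //.
  - exact/measurable_EFinP.
  - exact: (mrX _ mX).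
  - by move=> x x0; rewrite rE// real_normK ?num_real.
have JE : \int[mu]_x ((x ^+ 2)%:E)^-1 = \int[mu]_x ((r x)^-1 ^+ 2)%:E.
  apply: integral_eq_off0 => //.
  - apply: (mrX (fun y => y^-1 ^+ 2)%R).
    by apply: measurable_funX; exact: measurable_invr.
  - by move=> x x0; rewrite inve_sqr (negbTE x0) rE.
have LE : \int[mu]_x lne (`|x|%R)%:E = \int[mu]_x (ln (r x))%:E.
  apply: integral_eq_off0 => //.
  - by apply: mrX; exact: measurable_ln.
  - by move=> x x0; rewrite lne_norm (negbTE x0) rE.
have DE : \int[mu]_x ((`|x| - 1) ^+ 2)%:E = \int[mu]_x ((r x - 1) ^+ 2)%:E.
  apply: integral_eq_off0 => //.
  - exact/measurable_EFinP/measurable_funX/measurable_funB.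
  - apply: (mrX (fun y => (y - 1) ^+ 2)%R).
    exact/measurable_funX/measurable_funB.
  - by move=> x x0; rewrite rE.
rewrite IE JE LE DE; apply: HWI_positive => //.
- by rewrite -IE.
- by rewrite -JE.
Qed.

End rademacher_HWI.

Theorem theorem2p15 (R : realType) (mu : probability (measurableTypeR R) R)
    (mu_sym : symmetric_measure mu)
    (mu_mom2 : \int[mu]_x (x ^+ 2)%:E < +oo) :
  Gamma_rademacher mu <=
    W2 mu (rademacher R) * sqrte (Psistar_rademacher mu)
    - (2^-1)%:E * W2 mu (rademacher R) ^+ 2.
Proof.
have D_lty := abs_sub1_integral_lty mu_mom2.
rewrite W2_rademacher// sqr_sqrte; last first.
  by apply: integral_ge0 => x _; rewrite lee_fin sqr_ge0.
rewrite /Gamma_rademacher /Psistar_rademacher.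
have [J_lty|] := ltP (\int[mu]_x ((x ^+ 2)%:E)^-1) +oo; first exact: abs_HWI.
rewrite leye_eq => /eqP J_y.
(* This lets [+oo] absorb the second moment in [Psistar_rademacher]. *)
have I_Ny : \int[mu]_x (x ^+ 2)%:E != -oo.
  rewrite gt_eqF// (lt_le_trans ltNy0)// integral_ge0// => x _.
  by rewrite lee_fin sqr_ge0.
move: D_lty (abs_sub1_integral_gt0 J_y); rewrite J_y addye//.
case: (\int[mu]_x ((`|x| - 1) ^+ 2)%:E) => // D _ D_gt0.
(* [D] is now a positive real, so [sqrt D * +oo - D / 2] is [+oo]. *)
by rewrite /= gt0_muley ?lte_fin ?sqrtr_gt0// leey.
Qed.
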